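(* Let $K=\mathbb{F}_q$ be a finite field with $q\neq 2$. Let $\mathcal{C}$ be a clutter with $s$ edges, let $X^*$, $Y$, $I(X^* )\subset S=K[t_1,\ldots,t_s]$ and $I(Y)\subset S[u]=K[t_1,\ldots,t_s,t_{s+1}]$ be as defined in the context, and let $T=\{(x_1,\ldots,x_s) : x_i\in K^*\mbox{ for all } i\}$ be the affine torus in $\mathbb{A}^s=K^s$. The following are equivalent: ($\mathrm{a}_1$) $I(Y)$ is a complete intersection. ($\mathrm{a}_2$) $I(Y)=(t_1^{q-1}-t_{s+1}^{q-1},\ldots,t_s^{q-1}-t_{s+1}^{q-1})$. ($\mathrm{a}_3$) $X^*=T$. ($\mathrm{a}_4$) $I(X^* )=(t_1^{q-1}-1,\ldots,t_s^{q-1}-1)$.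
   Context: A clutter $\mathcal{C}$ is a family of subsets (edges) of a finite vertex set $\{y_1,\ldots,y_n\}$ such that no edge is contained in a different edge. Let $f_1,\ldots,f_s$ be the edges of $\mathcal{C}$ and let $v_i=\sum_{y_j\in f_i}e_j\in\{0,1\}^n$ be the characteristic vector of $f_i$, where $e_j$ is the $j$th unit vector. Put $K^*=K\setminus\{0\}$ and, for $x\in (K^* )^n$, $x^{v_i}=x_1^{v_{i1}}\cdots x_n^{v_{in}}$. Define $X^*=\{(x^{v_1},\ldots,x^{v_s}) : x\in (K^* )^n\}\subset\mathbb{A}^{s}=K^s$ and $Y=\{[(x^{v_1},\ldots,x^{v_s},1)] : x\in (K^* )^n\}\subset\mathbb{P}^{s}$ (projective space over $K$). $S=K[t_1,\ldots,t_s]$ and $S[u]$, $u=t_{s+1}$, are polynomial rings with the standard grading. $I(X^* )$ is the ideal of $S$ generated by all polynomials that vanish on $X^*$; $I(Y)$ is the ideal of $S[u]$ generated by the homogeneous polynomials that vanish on $Y$. The ideal $I(Y)$ is called a complete intersection if it can be generated by $s$ homogeneous polynomials of $S[u]$.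
   Formalization: The edges of the clutter are assumed nonempty; this excludes only the clutter whose single edge is the empty set, for which X*={1}, I(Y)=(t_1-t_2) is a complete intersection but X* is not T since q≠2. *)

(* Defs.v *)
From HB Require Import structures.
From mathcomp Require Import all_boot all_order all_algebra.
From mathcomp Require Import mpoly.

Set Implicit Arguments.
Unset Strict Implicit.
Unset Printing Implicit Defensive.

Import GRing.Theory.
Local Open Scope ring_scope.

Section Ideals.

Variable R : comNzRingType.

(* A subset of [R] is a [Prop]-valued predicate, since membership in an ideal
   of polynomials is not given by a boolean test. *)
Definition ideal_gen (G : R -> Prop) (p : R) : Prop :=
  exists (k : nat) (c g : 'I_k -> R),
    (forall i, G (g i)) /\ p = \sum_(i < k) c i * g i.

Definition ideal_gen_by (I : finType) (g : I -> R) : R -> Prop :=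
  ideal_gen (fun p => exists i, p = g i).

Definition ideal_eq (I J : R -> Prop) : Prop := forall p, I p <-> J p.

End Ideals.

Definition is_clutter (V : finType) (C : {set {set V}}) : Prop :=
  forall e f, e \in C -> f \in C -> e \subset f -> e = f.

Definition char_vec (n : nat) (e : {set 'I_n}) (j : 'I_n) : nat := j \in e.

Section ToricSets.

Variable K : finFieldType.

Definition monom (n : nat) (x : 'rV[K]_n) (v : 'I_n -> nat) : K :=
  \prod_(j < n) x 0 j ^+ v j.

Definition torus (n : nat) : {set 'rV[K]_n} :=
  [set x : 'rV[K]_n | [forall j, x 0 j != 0]].

Definition param (n s : nat) (v : 'I_s -> 'I_n -> nat) (x : 'rV[K]_n) :
    'rV[K]_s :=
  \row_(i < s) monom x (v i).

Definition affine_toric_set (n s : nat) (v : 'I_s -> 'I_n -> nat) :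
    {set 'rV[K]_s} :=
  [set param v x | x in torus n].

(* The point [a] of projective space, for a nonzero vector [a], is the
   equivalence class of [a] under multiplication by nonzero scalars. *)
Definition proj_pt (m : nat) (a : 'rV[K]_m) : {set 'rV[K]_m} :=
  [set c *: a | c : K & c != 0].

Definition proj_toric_set (n s : nat) (v : 'I_s -> 'I_n -> nat) :
    {set {set 'rV[K]_(s + 1)}} :=
  [set proj_pt (row_mx (param v x) (const_mx 1)) | x in torus n].

Definition is_homog (m : nat) (p : {mpoly K[m]}) : Prop :=
  exists d : nat, p \is d.-homog.

Definition vanishing_ideal (m : nat) (X : {set 'rV[K]_m}) :
    {mpoly K[m]} -> Prop :=
  ideal_gen (fun p : {mpoly K[m]} => forall a, a \in X -> p.@[a 0] = 0).

Definition proj_vanishing_ideal (m : nat) (Y : {set {set 'rV[K]_m}}) :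
    {mpoly K[m]} -> Prop :=
  ideal_gen (fun p : {mpoly K[m]} =>
    is_homog p /\ forall P a, P \in Y -> a \in P -> p.@[a 0] = 0).

(* [s] is the number of generators required, which is the height of the
   vanishing ideal of a nonempty finite set of points of P^s. *)
Definition complete_intersection (s : nat) (I : {mpoly K[s + 1]} -> Prop) :
    Prop :=
  exists g : 'I_s -> {mpoly K[s + 1]},
    (forall i, is_homog (g i)) /\ ideal_eq I (ideal_gen_by g).

End ToricSets.

(* Main.v *)
(* Orthogonality of characters on the torus (F_q^* )^n shows that a polynomial
   vanishing on the image of a monomial map has zero coefficient at every
   monomial that is alone in its class of characters. Exponents live modulo
   q - 1, so this applies to the pure powers t_i^d with d < q - 1 (the edges are
   distinct): they never occur in I(Y). The pure powers t_i^(q-1) do occur, in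
   t_i^(q-1) - u^(q-1), so if s forms generate I(Y), comparing the coefficients
   of t_1^(q-1), ..., t_s^(q-1) yields an invertible matrix; all the generators
   thus have degree q - 1 and span the same space as the t_i^(q-1) - u^(q-1).
   If X* misses a point of the torus, a product of factors
   u^(q-1) - (t_i - a_i u)^(q-1), equal to 1 at that point and to 0 at all other
   points of the torus, contradicts (a_2), and also (a_4) once u = 1. If X* = T,
   reducing exponents modulo q - 1 leaves a polynomial whose monomials have
   distinct characters, hence 0. *)
Require Import Defs.
From mathcomp Require Import all_boot all_order all_algebra.
From mathcomp Require Import fingroup finalg cyclic finfield.
From mathcomp Require Import mpoly.

Set Implicit Arguments.
Unset Strict Implicit.
Unset Printing Implicit Defensive.

Import GRing.Theory.
Local Open Scope ring_scope.

(** * Generated ideals and congruences modulo them *)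

Section IdealTheory.

Variable R : comNzRingType.
Implicit Types (G H : R -> Prop) (p q : R).

Lemma ideal_gen_mem G p : G p -> ideal_gen G p.
Proof.
by move=> Gp; exists 1%N, (fun=> 1), (fun=> p); split=> //; rewrite big_ord1 mul1r.
Qed.

Lemma ideal_genD G p q : ideal_gen G p -> ideal_gen G q -> ideal_gen G (p + q).
Proof.
move=> [k [c [g [Gg ->]]]] [l [d [h [Gh ->]]]].
exists (k + l)%N, (fun i => match split i with inl a => c a | inr b => d b end),
  (fun i => match split i with inl a => g a | inr b => h b end); split=> [i|].
  by case: (split i).
rewrite big_split_ord /=; congr (_ + _); apply: eq_bigr => i _.
  by rewrite (unsplitK (inl i)).
by rewrite (unsplitK (inr i)).
Qed.

Lemma ideal_genM G a p : ideal_gen G p -> ideal_gen G (a * p).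
Proof.
move=> [k [c [g [Gg ->]]]]; exists k, (fun i => a * c i), g; split=> //.
by rewrite mulr_sumr; apply: eq_bigr => i _; rewrite mulrA.
Qed.

Lemma ideal_gen0 G : ideal_gen G 0.
Proof. by exists 0%N, (fun=> 0), (fun=> 0); split=> [[]|] //; rewrite big_ord0. Qed.

Lemma ideal_gen_sum G (I : Type) (r : seq I) (P : pred I) (F : I -> R) :
  (forall i, P i -> ideal_gen G (F i)) -> ideal_gen G (\sum_(i <- r | P i) F i).
Proof.
move=> GF; elim/big_ind: _ => //; [exact: ideal_gen0 | exact: ideal_genD].
Qed.

Lemma ideal_gen_sub G H p :
  (forall g, G g -> ideal_gen H g) -> ideal_gen G p -> ideal_gen H p.
Proof.
move=> sGH [k [c [g [Gg ->]]]]; apply: ideal_gen_sum => i _.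
exact/ideal_genM/sGH/Gg.
Qed.

(** Coefficients attached to repeated uses of one generator are added up, which leaves one
    coefficient per index, as the matrix argument for (a_1) requires. *)
Lemma ideal_gen_byP (I : finType) (g : I -> R) p :
  ideal_gen_by g p <-> exists c : I -> R, p = \sum_i c i * g i.
Proof.
split=> [[k [c [h [/fin_all_exists [a ha] ->]]]]|[c ->]]; last first.
  by apply: ideal_gen_sum => i _; apply/ideal_genM/ideal_gen_mem; exists i.
exists (fun i => \sum_(j < k | a j == i) c j).
rewrite (partition_big a predT) //=; apply: eq_bigr => i _.
by rewrite mulr_suml; apply: eq_bigr => j /eqP <-; rewrite ha.
Qed.

Lemma ideal_gen_by_mem (I : finType) (g : I -> R) i : ideal_gen_by g (g i).
Proof. by apply: ideal_gen_mem; exists i. Qed.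

Lemma ideal_congM G a b c d :
  ideal_gen G (a - b) -> ideal_gen G (c - d) -> ideal_gen G (a * c - b * d).
Proof.
move=> Gab Gcd; have -> : a * c - b * d = c * (a - b) + b * (c - d).
  by rewrite !mulrBr [c * a]mulrC [c * b]mulrC addrA subrK.
by apply: ideal_genD; apply: ideal_genM.
Qed.

Lemma ideal_cong_refl G a : ideal_gen G (a - a).
Proof. by rewrite subrr; apply: ideal_gen0. Qed.

Lemma ideal_cong_prod G (I : finType) (a b : I -> R) :
  (forall i, ideal_gen G (a i - b i)) ->
  ideal_gen G (\prod_i a i - \prod_i b i).
Proof.
move=> Gab; elim/big_ind2: _ => [|x1 y1 x2 y2|//]; first exact: ideal_cong_refl.
exact: ideal_congM.
Qed.

Lemma ideal_congX G a b k : ideal_gen G (a - b) -> ideal_gen G (a ^+ k - b ^+ k).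
Proof.
move=> Gab; elim: k => [|k IHk]; first by rewrite !expr0; apply: ideal_cong_refl.
by rewrite !exprS; apply: ideal_congM.
Qed.

(** Division of [e i] by [N] splits off a power of [t i ^+ N], which is congruent to the same power
    of [y ^+ N]. The projective case takes [y] to be the last variable, the affine case takes
    [y = 1]. *)
Lemma ideal_cong_modexp (s N : nat) (t : 'I_s -> R) (y : R) (e : 'I_s -> nat) :
  ideal_gen_by (fun i => t i ^+ N - y ^+ N)
    (\prod_i t i ^+ e i - \prod_i (t i ^+ (e i %% N) * y ^+ (e i %/ N * N))).
Proof.
apply: ideal_cong_prod => i; rewrite {1}(divn_eq (e i) N) exprD mulrC.
apply: ideal_congM; first exact: ideal_cong_refl.
rewrite mulnC !exprM; apply: ideal_congX.
exact: ideal_gen_by_mem.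
Qed.

End IdealTheory.

(** * Power sums over K^* and orthogonality of characters *)

Section PowerSums.

Variable K : finFieldType.
Local Notation N := #|K|.-1.

Lemma card_pred_gt0 : (0 < N)%N.
Proof. by rewrite -subn1 subn_gt0 finNzRing_gt1. Qed.

Lemma expf_card_pred (a : K) : a != 0 -> a ^+ N = 1.
Proof.
move=> a0; apply: (mulfI a0).
by rewrite -exprS prednK ?expf_card ?mulr1 // ltnW ?finNzRing_gt1.
Qed.

(** If [N] divides [w], all terms are 1 and the sum is q - 1 = -1. Otherwise some nonzero [b] has
    [b ^+ w != 1], and the substitution of [a * b] for [a] multiplies the sum by [b ^+ w]. *)
Lemma sum_exp_neq0 (w : nat) :
  (\sum_(a : K | a != 0) a ^+ w != 0) = (N %| w)%N.
Proof.
have [dvdNw|ndvd] := boolP (N %| w)%N.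
  rewrite (eq_bigr (fun=> 1)); last first.
    by move=> a a0; rewrite -(divnK dvdNw) mulnC exprM expf_card_pred // expr1n.
  rewrite sumr_const cardC1.
  have: (1 : K) *+ #|K| = 0.
    by rewrite -FinRing.zmodXgE -cardsT expg_cardG ?inE.
  rewrite -(@prednK #|K|) ?(ltnW (finNzRing_gt1 K)) // mulrSr.
  by move/eqP; rewrite addr_eq0 => /eqP->; rewrite oppr_eq0 oner_eq0.
apply: negbTE; rewrite negbK.
have [b b0 bw] : exists2 b : K, b != 0 & b ^+ w != 1.
  apply/exists_inP; apply: contraT; rewrite negb_exists_in => /forall_inP b1.
  (* If no such [b] existed, all [N] nonzero elements would be roots of unity of order [w %% N],
     which is less than [N]. *)
  have r_gt0 : (0 < w %% N)%N by rewrite lt0n.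
  have := @max_unity_roots K _ (enum (predC1 (0 : K))) r_gt0.
  rewrite enum_uniq -cardE cardC1 leqNgt ltn_mod card_pred_gt0; apply=> //.
  apply/allP => b; rewrite mem_enum => b0; apply/unity_rootP.
  have := b1 b b0; rewrite negbK {1}(divn_eq w N) exprD mulnC exprM.
  by rewrite expf_card_pred // expr1n mul1r => /eqP.
apply/eqP/(mulIf (_ : b ^+ w - 1 != 0)); first by rewrite subr_eq0.
rewrite mul0r mulrBr mulr1 mulr_suml; apply/eqP; rewrite subr_eq0; apply/eqP.
rewrite [RHS](reindex_inj (mulIf b0)); apply: eq_big => a.
  by rewrite mulf_eq0 (negPf b0) orbF.
by rewrite exprMn.
Qed.

Lemma sum_torus_monom (n : nat) (w : 'I_n -> nat) :
  \sum_(x in torus K n) monom x w = \prod_j \sum_(a : K | a != 0) a ^+ w j.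
Proof.
rewrite bigA_distr_big (reindex (fun h : {ffun 'I_n -> K} => \row_j h j)) /=.
  apply: eq_big => h; last by move=> _; apply: eq_bigr => j _; rewrite mxE.
  by rewrite inE; apply: eq_forallb => j; rewrite mxE.
exists (fun x => [ffun j => x 0 j]) => [h _|x _].
  by apply/ffunP => j; rewrite ffunE mxE.
by apply/rowP => j; rewrite mxE ffunE.
Qed.

(* Multiplying by the inverse character of [m0] and summing over the torus
   kills every monomial except those in the residue class of [m0]. *)
Lemma coef_torus_vanish (n s : nat) (v : 'I_s -> 'I_n -> nat)
    (p : {mpoly K[s]}) (m0 : 'X_{1..s}) :
  (forall x, x \in torus K n -> p.@[param v x 0] = 0) ->
  (forall m, m \in msupp p ->
     (forall j, \sum_k m k * v k j = \sum_k m0 k * v k j %[mod N])%N -> m = m0) ->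
  p@_m0 = 0.
Proof.
move=> p0 classE; pose E (m : 'X_{1..s}) j := (\sum_k m k * v k j)%N.
apply/eqP/contraT => pm0.
(* Since [N.-1] is -1 modulo [N], the first summand is the exponent of the inverse character of
   [m0], written without subtraction. *)
pose w m j := (N.-1 * E m0 j + E m j)%N.
have w_dvd m j : (N %| w m j)%N = (E m j == E m0 j %[mod N]).
  rewrite -(eqn_modDl (N.-1 * E m0 j)) -mulSnr prednK ?card_pred_gt0 //.
  by rewrite modnMr.
have : \sum_(x in torus K n)
    monom x (fun j => N.-1 * E m0 j)%N * p.@[param v x 0] = 0.
  by apply: big1 => x Tx; rewrite p0 ?mulr0.
under eq_bigr => x _.
  rewrite mevalE mulr_sumr.
  under eq_bigr => m _.
    rewrite mulrCA [X in _ * X](_ : _ = monom x (w m)).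
      over.
    under eq_bigr => k _ do rewrite mxE /monom -prodrXl.
    rewrite exchange_big -big_split; apply: eq_bigr => j _ /=.
    rewrite /w exprD /E expr_sum; congr (_ * _); apply: eq_bigr => k _.
    by rewrite -exprM mulnC.
  over.
rewrite exchange_big /=.
under eq_bigr => m _ do rewrite -mulr_sumr sum_torus_monom.
rewrite (bigD1_seq m0) ?msupp_uniq ?mcoeff_msupp //=.
rewrite [X in _ + X]big1_seq ?addr0.
  move/eqP; rewrite mulf_eq0 (negPf pm0) /= => /prodf_eq0 [j _ /negPn].
  by rewrite sum_exp_neq0 w_dvd eqxx.
move=> m /andP[m_neq m_supp].
suff /existsP[j nj] : [exists j, E m j != E m0 j %[mod N]].
  by rewrite (bigD1 j) //= -w_dvd -sum_exp_neq0 negbK in nj *;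
    rewrite (eqP nj) mul0r mulr0.
apply: contraNT m_neq; rewrite negb_exists => /forallP Em.
by apply/eqP/classE => // j; apply/eqP; have := Em j; rewrite negbK.
Qed.

End PowerSums.

(** * Vanishing ideals of toric sets and of the torus *)

Section VanishingIdeals.

Variable K : finFieldType.
Local Notation N := #|K|.-1.

Lemma ideal_gen_meval (m : nat) (G : {mpoly K[m]} -> Prop) (a : 'I_m -> K) p :
  (forall g, G g -> g.@[a] = 0) -> ideal_gen G p -> p.@[a] = 0.
Proof.
move=> G0 [k [c [g [Gg ->]]]]; rewrite raddf_sum big1 // => i _.
by rewrite /= mevalM (G0 (g i)) ?mulr0.
Qed.

Lemma vanishing_idealP (m : nat) (X : {set 'rV[K]_m}) p :
  vanishing_ideal X p <-> forall a, a \in X -> p.@[a 0] = 0.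
Proof.
split=> [Ip a Xa|]; last exact: ideal_gen_mem.
by apply: ideal_gen_meval Ip => g; apply.
Qed.

Lemma torus_neq0 (n : nat) (x : 'rV[K]_n) j : x \in torus K n -> x 0 j != 0.
Proof. by rewrite inE => /forallP. Qed.

Lemma monom_neq0 (n : nat) (x : 'rV[K]_n) w : x \in torus K n -> monom x w != 0.
Proof.
by move=> Tx; apply/prodf_neq0 => j _; rewrite expf_neq0 ?torus_neq0.
Qed.

Lemma affine_toric_set_sub_torus (n s : nat) (v : 'I_s -> 'I_n -> nat) :
  affine_toric_set K v \subset torus K s.
Proof.
apply/subsetP => _ /imsetP[x Tx ->]; rewrite inE; apply/forallP => i.
by rewrite mxE monom_neq0.
Qed.

Lemma monom_delta (n : nat) (x : 'rV[K]_n) i :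
  monom x (fun j => (i == j : nat)) = x 0 i.
Proof.
rewrite /monom (bigD1 i) //= eqxx expr1 big1 ?mulr1 // => j.
by rewrite eq_sym => /negPf->.
Qed.

(** This makes the torus itself a parametrized set, so that the results on monomial maps apply to
    it. *)
Lemma param_delta (n : nat) (x : 'rV[K]_n) :
  param (fun i j => (i == j : nat)) x = x.
Proof. by apply/rowP => i; rewrite mxE monom_delta. Qed.

(* The exponent vectors of the parametrization of [Y]: the last coordinate of
   its points, which is 1, is the monomial with exponent vector 0. *)
Definition extend0 (n s : nat) (v : 'I_s -> 'I_n -> nat) (k : 'I_(s + 1)) :
    'I_n -> nat :=
  match split k with inl i => v i | inr _ => fun=> 0%N end.

Lemma extend0_lshift n s (v : 'I_s -> 'I_n -> nat) i :
  extend0 v (lshift 1 i) = v i.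
Proof. by rewrite /extend0 (unsplitK (inl i)). Qed.

Lemma extend0_rshift n s (v : 'I_s -> 'I_n -> nat) i j :
  extend0 v (rshift s i) j = 0%N.
Proof. by rewrite /extend0 (unsplitK (inr i)). Qed.

Lemma param_extend0 n s (v : 'I_s -> 'I_n -> nat) (x : 'rV[K]_n) :
  param (extend0 v) x = row_mx (param v x) (const_mx 1).
Proof.
apply/rowP => k; rewrite -(splitK k); case: (split k) => i /=.
  by rewrite row_mxEl !mxE extend0_lshift.
rewrite row_mxEr !mxE /monom big1 // => j _.
by rewrite extend0_rshift expr0.
Qed.

Lemma X_homog (m : nat) (i : 'I_m) : ('X_i : {mpoly K[m]}) \is 1.-homog.
Proof. by rewrite dhomogX /= mdeg1. Qed.

Lemma homogX1 (m k : nat) (p : {mpoly K[m]}) :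
  p \is 1.-homog -> p ^+ k \is k.-homog.
Proof. by move=> /(dhomogMn k); rewrite mul1n. Qed.

Section ProjToric.

Variables (n s : nat) (v : 'I_s -> 'I_n -> nat).
Local Notation Y := (proj_toric_set K v).
Local Notation IY := (proj_vanishing_ideal Y).
Local Notation t := (fun i : 'I_s => 'X_(lshift 1 i) : {mpoly K[s + 1]}).
Local Notation u := ('X_(rshift s ord0) : {mpoly K[s + 1]}).

(** Evaluation is a ring morphism, so vanishing at each representative passes from the homogeneous
    generators to every element of the ideal. *)
Lemma proj_vanishing_meval p c x : IY p -> c != 0 -> x \in torus K n ->
  p.@[(c *: row_mx (param v x) (const_mx 1)) 0] = 0.
Proof.
move=> Ip c0 Tx; apply: ideal_gen_meval Ip => g [_].
by apply; [apply: imset_f Tx | apply/imsetP; exists c; rewrite ?inE].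
Qed.

Lemma homog_proj_vanishing p : is_homog p ->
  (forall c x, c != 0 -> x \in torus K n ->
    p.@[(c *: row_mx (param v x) (const_mx 1)) 0] = 0) -> IY p.
Proof.
move=> p_homog p0; apply: ideal_gen_mem; split=> // _ a /imsetP[x Tx ->].
by case/imsetP => c; rewrite inE => c0 ->; apply: p0.
Qed.

Lemma proj_vanishing_param p x : IY p -> x \in torus K n ->
  p.@[param (extend0 v) x 0] = 0.
Proof.
move=> Ip Tx; rewrite param_extend0 -[row_mx _ _]scale1r.
by apply: proj_vanishing_meval; rewrite ?oner_neq0.
Qed.

Lemma coneE_t c (a : 'rV[K]_s) i :
  (t i).@[(c *: row_mx a (const_mx 1 : 'rV_1)) 0] = c * a 0 i.
Proof. by rewrite mevalXU mxE row_mxEl. Qed.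

Lemma coneE_u c (a : 'rV[K]_s) :
  u.@[(c *: row_mx a (const_mx 1 : 'rV_1)) 0] = c.
Proof. by rewrite mevalXU mxE row_mxEr mxE mulr1. Qed.

Definition cone_binomial i := t i ^+ N - u ^+ N.

Lemma cone_binomial_eval i c (a : 'rV[K]_s) : c != 0 -> a \in torus K s ->
  (cone_binomial i).@[(c *: row_mx a (const_mx 1 : 'rV_1)) 0] = 0.
Proof.
move=> c0 Ta; rewrite mevalB !rmorphXn /= coneE_t coneE_u.
by rewrite !expf_card_pred ?subrr ?mulf_neq0 ?torus_neq0.
Qed.

Lemma cone_binomial_homog i : cone_binomial i \is N.-homog.
Proof. by rewrite rpredB // homogX1 ?X_homog. Qed.

Lemma cone_binomial_vanishing i : IY (cone_binomial i).
Proof.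
apply: homog_proj_vanishing; first by exists N; apply: cone_binomial_homog.
move=> c x c0 Tx; apply: cone_binomial_eval => //.
exact/(subsetP (affine_toric_set_sub_torus v))/imset_f.
Qed.

Lemma homog_prod (I : finType) (m d : nat) (F : I -> {mpoly K[m]}) :
  (forall i, F i \is d.-homog) -> \prod_i F i \is (#|I| * d).-homog.
Proof.
move=> Fd; rewrite -sum_nat_const.
elim/big_rec2: _ => [|i p e _]; first exact: dhomog1.
exact: dhomogM.
Qed.

Lemma proj_toric_full : ideal_eq IY (ideal_gen_by cone_binomial) ->
  affine_toric_set K v = torus K s.
Proof.
move=> IYE; apply/eqP; rewrite eqEsubset affine_toric_set_sub_torus.
apply/subsetP => a Ta; apply: contraT => aX.
(* On the cone over a torus point [b], factor [i] vanishes exactly when [b 0 i] differs from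
   [a 0 i]; each factor is homogeneous of degree [N]. *)
pose h := \prod_(i < s) (u ^+ N - (t i - a 0 i *: u) ^+ N).
have h_eval c b : h.@[(c *: row_mx b (const_mx 1 : 'rV_1)) 0] =
    \prod_(i < s) (c ^+ N - (c * (b 0 i - a 0 i)) ^+ N).
  rewrite rmorph_prod; apply: eq_bigr => i _ /=.
  rewrite mevalB !rmorphXn /= mevalB mevalZ coneE_t coneE_u mulrBr.
  by rewrite [a 0 i * c]mulrC.
have Ih : IY h.
  apply: homog_proj_vanishing.
    exists (#|'I_s| * N)%N; apply: homog_prod => i.
    rewrite rpredB // homogX1 ?X_homog //.
    by rewrite rpredB ?rpredZ ?X_homog.
  move=> c x c0 Tx; rewrite h_eval; apply/eqP/prodf_eq0.
  have /existsP[i xi] : [exists i, param v x 0 i != a 0 i].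
    apply: contraNT aX; rewrite negb_exists => /forallP xa.
    apply/imsetP; exists x => //; apply/rowP => i.
    by have := xa i; rewrite negbK => /eqP.
  exists i => //; rewrite exprMn !expf_card_pred ?subr_eq0 //.
  by rewrite mulr1.
have h1 : h.@[(1 *: row_mx a (const_mx 1 : 'rV_1)) 0] = 1.
  rewrite h_eval big1 // => i _.
  (* Here [0 ^+ N] is 0 and not 1 because [N] is positive. *)
  by rewrite subrr mulr0 expr1n expr0n gtn_eqF ?card_pred_gt0 ?subr0.
have := oner_neq0 K; rewrite -h1 => /eqP[].
apply: ideal_gen_meval (proj1 (IYE h) Ih) => _ [i ->].
by apply: cone_binomial_eval; rewrite ?oner_neq0.
Qed.

End ProjToric.

(** This is the argument of [proj_toric_full] with u = 1: [h] is the indicator of a missed torus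
    point [a], yet every generator vanishes at [a]. *)
Lemma affine_toric_full (n s : nat) (v : 'I_s -> 'I_n -> nat) :
  ideal_eq (vanishing_ideal (affine_toric_set K v))
    (ideal_gen_by (fun i : 'I_s => ('X_i : {mpoly K[s]}) ^+ N - 1)) ->
  affine_toric_set K v = torus K s.
Proof.
move=> IXE; apply/eqP; rewrite eqEsubset affine_toric_set_sub_torus.
apply/subsetP => a Ta; apply: contraT => aX.
pose h : {mpoly K[s]} := \prod_(i < s) (1 - ('X_i - (a 0 i)%:MP) ^+ N).
have h_eval b : h.@[b 0] = \prod_(i < s) (1 - (b 0 i - a 0 i) ^+ N).
  rewrite rmorph_prod; apply: eq_bigr => i _ /=.
  by rewrite mevalB meval1 rmorphXn /= mevalB mevalXU mevalC.
have Ih : vanishing_ideal (affine_toric_set K v) h.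
  apply/vanishing_idealP => b Xb; rewrite h_eval; apply/eqP/prodf_eq0.
  have /existsP[i bi] : [exists i, b 0 i != a 0 i].
    apply: contraNT aX; rewrite negb_exists => /forallP ba.
    suff <- : b = a by [].
    by apply/rowP => i; have := ba i; rewrite negbK => /eqP.
  by exists i => //; rewrite expf_card_pred ?subr_eq0.
have h1 : h.@[a 0] = 1.
  rewrite h_eval big1 // => i _.
  by rewrite subrr expr0n gtn_eqF ?card_pred_gt0 ?subr0.
have := oner_neq0 K; rewrite -h1 => /eqP[].
apply: ideal_gen_meval (proj1 (IXE h) Ih) => _ [i ->].
by rewrite mevalB meval1 rmorphXn /= mevalXU expf_card_pred ?subrr ?torus_neq0.
Qed.

(* Replace each monomial ['X_[m]] of [p] by its normal form ['X_[red m]]: the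
   result still vanishes on the image of [v], and its monomials have distinct
   characters on the torus, hence it is 0. *)
Lemma vanishing_normal_form (n s : nat) (v : 'I_s -> 'I_n -> nat)
    (G : {mpoly K[s]} -> Prop) (red : 'X_{1..s} -> 'X_{1..s}) (p : {mpoly K[s]}) :
  (forall m, ideal_gen G ('X_[m] - 'X_[red m])) ->
  (forall g x, G g -> x \in torus K n -> g.@[param v x 0] = 0) ->
  (forall m m', m \in msupp p -> m' \in msupp p ->
     (forall j, \sum_k red m k * v k j = \sum_k red m' k * v k j %[mod N])%N ->
     red m = red m') ->
  (forall x, x \in torus K n -> p.@[param v x 0] = 0) ->
  ideal_gen G p.
Proof.
move=> redG G0 red_inj p0.
pose r := \sum_(m <- msupp p) p@_m *: 'X_[red m] : {mpoly K[s]}.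
have Gpr : ideal_gen G (p - r).
  rewrite {1}[p]mpolyE -sumrB; apply: ideal_gen_sum => m _.
  by rewrite -scalerBr -mul_mpolyC; apply: ideal_genM.
have r_supp m : m \in msupp r -> exists2 m', m' \in msupp p & red m' = m.
  rewrite mcoeff_msupp raddf_sum /= => r_m.
  have /hasP[m' pm' /eqP] : has (fun m' => red m' == m) (msupp p).
    apply: contraNT r_m => /hasPn no_m; apply/eqP/big1_seq => m' /= pm'.
    by rewrite mcoeffZ mcoeffX (negPf (no_m _ pm')) mulr0.
  by exists m'.
suff r0 : r = 0 by rewrite r0 subr0 in Gpr.
apply/mpolyP => m; rewrite mcoeff0.
have [rm|/memN_msupp_eq0 //] := boolP (m \in msupp r).
apply: (@coef_torus_vanish _ n _ v) => [x Tx|m' rm' E].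
  have : (p - r).@[param v x 0] = 0.
    by apply: ideal_gen_meval Gpr => g /G0; apply.
  by rewrite mevalB p0 // sub0r => /eqP; rewrite oppr_eq0 => /eqP.
have [m1 pm1 E1] := r_supp _ rm; have [m2 pm2 E2] := r_supp _ rm'.
by rewrite -E1 -E2; apply: red_inj => // j; rewrite E1 E2.
Qed.

Lemma torus_vanishing_ideal (s : nat) :
  ideal_eq (vanishing_ideal (torus K s))
    (ideal_gen_by (fun i : 'I_s => ('X_i : {mpoly K[s]}) ^+ N - 1)).
Proof.
have G0 (g : {mpoly K[s]}) x :
    (exists i : 'I_s, g = 'X_i ^+ N - 1) -> x \in torus K s -> g.@[x 0] = 0.
  move=> [i ->] Tx.
  by rewrite mevalB meval1 rmorphXn /= mevalXU expf_card_pred ?subrr ?torus_neq0.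
move=> p; split=> [/vanishing_idealP p0|Gp]; last first.
  by apply/vanishing_idealP => x Tx; apply: ideal_gen_meval Gp => g /G0; apply.
pose red (m : 'X_{1..s}) := [multinom (m i %% N)%N | i < s].
pose v (i j : 'I_s) := (i == j : nat).
apply: (@vanishing_normal_form s s v _ red).
- move=> m; have := @ideal_cong_modexp _ s N (fun i => 'X_i) (1 : {mpoly K[s]}) m.
  rewrite (mpolyXE_id _ m) (mpolyXE_id _ (red m)) expr1n.
  under [X in _ - X]eq_bigr => i _ do
    rewrite expr1n mulr1 -(mnmE (fun i => m i %% N)%N).
  by [].
- by move=> g x Gg Tx; rewrite param_delta; apply: G0.
- move=> m m' _ _ E; apply/mnmP => j; have := E j.
  have vE (m1 : 'X_{1..s}) : (\sum_k m1 k * v k j = m1 j)%N.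
    rewrite (bigD1 j) //= {1}/v eqxx muln1 big1 ?addn0 // => k /negPf kj.
    by rewrite /v kj muln0.
  by rewrite !vE !mnmE !modn_mod.
- by move=> x Tx; rewrite param_delta p0.
Qed.

End VanishingIdeals.

(** * The ideal of Y when X* is the torus, and the degrees of s generators *)

Section CompleteIntersection.

Variable K : finFieldType.
Local Notation N := #|K|.-1.

Lemma proj_torus_ideal (n s : nat) (v : 'I_s -> 'I_n -> nat) :
  affine_toric_set K v = torus K s ->
  ideal_eq (proj_vanishing_ideal (proj_toric_set K v))
    (ideal_gen_by (@cone_binomial K s)).
Proof.
move=> XT p; split; last first.
  by apply: ideal_gen_sub => _ [i ->]; apply: cone_binomial_vanishing.
apply: ideal_gen_sub => {}p [[d p_homog] p0].
pose e (i j : 'I_s) := (i == j : nat).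
(* The multiples of [N] removed from the exponents of the t_i are moved to u, so the total degree is
   preserved. *)
pose red (m : 'X_{1..s + 1}) : 'X_{1..s + 1} :=
  [multinom match split k with
    | inl i => m (lshift 1 i) %% N
    | inr _ => \sum_(i < s) m (lshift 1 i) %/ N * N + m (rshift s ord0)
    end%N | k < s + 1].
have red_l m i : red m (lshift 1 i) = (m (lshift 1 i) %% N)%N.
  by rewrite mnmE (unsplitK (inl i)).
have red_r m : red m (rshift s ord0) =
    (\sum_(i < s) m (lshift 1 i) %/ N * N + m (rshift s ord0))%N.
  by rewrite mnmE (unsplitK (inr ord0)).
have mdegS (m : 'X_{1..s + 1}) :
    mdeg m = (\sum_(i < s) m (lshift 1 i) + m (rshift s ord0))%N.
  by rewrite mdegE big_split_ord big_ord1.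
have mdeg_red m : mdeg (red m) = mdeg m.
  rewrite !mdegS red_r addnA; congr (_ + _)%N.
  rewrite -big_split; apply: eq_bigr => i _ /=.
  by rewrite red_l addnC -divn_eq.
have mpolyXS (m : 'X_{1..s + 1}) : 'X_[m] =
    (\prod_(i < s) 'X_(lshift 1 i) ^+ m (lshift 1 i)) *
      'X_(rshift s ord0) ^+ m (rshift s ord0) :> {mpoly K[s + 1]}.
  by rewrite mpolyXE_id big_split_ord big_ord1.
apply: (@vanishing_normal_form K s (s + 1) (extend0 e) _ red).
- move=> m; rewrite (mpolyXS m) (mpolyXS (red m)) red_r exprD mulrA.
  apply: ideal_congM; last exact: ideal_cong_refl.
  rewrite expr_sum -big_split /=.
  under [X in _ - X]eq_bigr => i _ do rewrite red_l.
  exact: ideal_cong_modexp.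
- move=> _ x [i ->] Tx; rewrite param_extend0 param_delta -[row_mx _ _]scale1r.
  by apply: cone_binomial_eval; rewrite ?oner_neq0.
- move=> m m' pm pm' E.
  have El i : red m (lshift 1 i) = red m' (lshift 1 i).
    have := E i.
    have eE (m1 : 'X_{1..s + 1}) :
        (\sum_k m1 k * extend0 e k i = m1 (lshift 1 i))%N.
      rewrite big_split_ord big_ord1 /= extend0_rshift muln0 addn0.
      rewrite (bigD1 i) //= extend0_lshift /e eqxx muln1 big1 ?addn0 //.
      by move=> k /negPf ki; rewrite extend0_lshift ki muln0.
    by rewrite !eE !red_l !modn_mod.
  (* Characters do not see the exponent of u, which is 1 at these points; it is recovered from the
     common degree of the monomials of [p]. *)
  apply/mnmP => k; rewrite -(splitK k); case: (split k) => [//|o].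
  rewrite (ord1 o) /=; have: mdeg (red m) = mdeg (red m').
    by rewrite !mdeg_red !(dhomog_mf p_homog).
  by rewrite !mdegS; under eq_bigr do rewrite El; move/addnI.
(* This is where [XT] enters: each torus point is [param v y] for some [y], hence [p] vanishes
   there. *)
- move=> x; rewrite -XT => /imsetP[y Ty ->].
  rewrite param_extend0 param_delta.
  apply: (p0 (proj_pt (row_mx (param v y) (const_mx 1)))); first exact: imset_f.
  by apply/imsetP; exists 1; rewrite ?scale1r // inE oner_neq0.
Qed.

(** The pure power is alone in its class among monomials of degree [d]: 0/1 exponents and [d < N]
    turn the congruences into equalities, and these force [v k = v i] for every variable [k] that
    occurs. *)
Lemma pure_power_coef_eq0 (n s d : nat) (v : 'I_s -> 'I_n -> nat)
    (p : {mpoly K[s]}) (i : 'I_s) :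
  (d < N)%N -> (forall k j, (v k j <= 1)%N) -> (forall k, v k =1 v i -> k = i) ->
  p \is d.-homog -> (forall x, x \in torus K n -> p.@[param v x 0] = 0) ->
  p@_(U_(i) *+ d) = 0.
Proof.
move=> dN v_le1 v_inj p_homog p0; apply: (coef_torus_vanish p0) => m pm E.
have md : (\sum_k m k = d)%N by rewrite -mdegE (dhomog_mf p_homog).
have Ed j : (\sum_k m k * v k j = d * v i j)%N.
  have le_d k : (d * v k j <= d)%N by rewrite -{2}[d]muln1 leq_mul2l v_le1 orbT.
  have sum_le : (\sum_k m k * v k j <= d)%N.
    by rewrite -md leq_sum // => k _; rewrite -{2}[m k]muln1 leq_mul2l v_le1 orbT.
  have := E j; rewrite [in X in _ = X](bigD1 i) //= [X in (_ + X)%N]big1.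
    rewrite addn0 mulmnE mnm1E eqxx mul1n !modn_small //.
      exact: leq_ltn_trans dN.
    exact: leq_ltn_trans dN.
  by move=> k /negPf ki; rewrite mulmnE mnm1E eq_sym ki mul0n.
have m0 k : k != i -> m k = 0%N.
  apply: contraNeq => mk; apply/eqP/v_inj => j.
  have [vij|] := posnP (v i j).
    have /eqP := Ed j; rewrite vij muln0 sum_nat_eq0 => /forallP/(_ k).
    by rewrite muln_eq0 (negPf mk) => /eqP.
  move=> vij; have vij1 : v i j = 1%N by apply/eqP; rewrite eqn_leq v_le1.
  (* Where [v i j] is 1, the weighted sum of the [v k j] equals the total degree, so no variable
     that occurs may have [v k j = 0]. *)
  have : (\sum_k m k * (1 - v k j) == 0)%N.
    rewrite -(eqn_add2l (d * v i j)) -{1}Ed -big_split /= vij1 addn0 muln1 -md.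
    apply/eqP/eq_bigr => l _.
    by rewrite -mulnDr subnKC // muln1.
  rewrite sum_nat_eq0 => /forallP/(_ k); rewrite muln_eq0 (negPf mk) subn_eq0 /=.
  by move=> vkj; apply/eqP; rewrite vij1 eqn_leq v_le1.
apply/mnmP => k; rewrite mulmnE mnm1E eq_sym.
have [->|/m0-> //] := eqVneq k i.
by rewrite mul1n -md (bigD1 i) //= big1 ?addn0.
Qed.

Lemma mcoeffM_eq0 (s : nat) (c g : {mpoly K[s]}) (m : 'X_{1..s}) :
  (forall m1 m2, m = (m1 + m2)%MM -> m2 \in msupp g -> c@_m1 * g@_m2 = 0) ->
  (c * g)@_m = 0.
Proof.
move=> cg0; rewrite mcoeffM big1 // => k /eqP mk.
have [gk|/memN_msupp_eq0->] := boolP (bmnm k.2 \in msupp g); last by rewrite mulr0.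
exact: cg0.
Qed.

(** For degree reasons only the constant term of [c] can contribute. *)
Lemma mcoeff_mul_homog (s d : nat) (c g : {mpoly K[s]}) (m : 'X_{1..s}) :
  g \is d.-homog -> mdeg m = d -> (c * g)@_m = c@_0 * g@_m.
Proof.
move=> g_homog md; rewrite -{1}[c](subrK (c@_0)%:MP) mulrDl mcoeffD mcoeffCM.
rewrite mcoeffM_eq0 ?add0r // => m1 m2 mE gm2.
move: md; rewrite mE mdegD (dhomog_mf g_homog gm2) => /eqP.
rewrite -{2}[d]add0n eqn_add2r mdeg_eq0 => /eqP->.
by rewrite mcoeffB mcoeffC eqxx mulr1 subrr mul0r.
Qed.

(** A divisor of a pure power is a pure power of the same variable, and homogeneity of [g] fixes its
    exponent at [d]. *)
Lemma mcoeff_mul_pure_power (s d e : nat) (c g : {mpoly K[s]}) (i : 'I_s) :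
  g \is d.-homog -> g@_(U_(i) *+ d) = 0 -> (c * g)@_(U_(i) *+ e) = 0.
Proof.
move=> g_homog gd; apply: mcoeffM_eq0 => m1 m2 mE gm2.
have m2_0 j : j != i -> m2 j = 0%N.
  move=> ji; have := congr1 (fun m : 'X_{1..s} => m j) mE.
  rewrite /= mulmnE mnm1E mnmDE eq_sym (negPf ji) mul0n => /esym/eqP.
  by rewrite addn_eq0 => /andP[_ /eqP].
suff -> : m2 = (U_(i) *+ d)%MM by rewrite gd mulr0.
apply/mnmP => j; rewrite mulmnE mnm1E eq_sym.
have [->|/m2_0-> //] := eqVneq j i.
have <- : mdeg m2 = d := dhomog_mf g_homog gm2.
by rewrite mul1n mdegE (bigD1 i) //= big1 ?addn0.
Qed.

Lemma mcoeff_mul_deg_gt (s d : nat) (c g : {mpoly K[s]}) (m : 'X_{1..s}) :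
  g \is d.-homog -> (mdeg m < d)%N -> (c * g)@_m = 0.
Proof.
move=> g_homog md; apply: mcoeffM_eq0 => m1 m2 mE gm2.
by move: md; rewrite mE mdegD (dhomog_mf g_homog gm2) ltnNge leq_addl.
Qed.

Lemma mcoeff_cone_binomial (s : nat) (i j : 'I_s) :
  (cone_binomial K i)@_(U_(lshift 1 j) *+ N) = (i == j)%:R.
Proof.
have pure (k l : 'I_(s + 1)) :
    ('X_k ^+ N : {mpoly K[s + 1]})@_(U_(l) *+ N) = (k == l)%:R.
  rewrite mcoeffXn; congr (_ %:R); congr nat_of_bool.
  apply/eqP/eqP => [/mnmP/(_ l)|-> //]; rewrite !mulmnE !mnm1E eqxx mul1n.
  by case: eqP => // _ /eqP; rewrite mul0n eq_sym (gtn_eqF (card_pred_gt0 K)).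
rewrite mcoeffB !pure eq_rlshift subr0.
by rewrite (inj_eq (@lshift_inj _ _)).
Qed.

(* The coefficients of the pure powers t_j^(q-1) identify the degree q-1 part
   of an ideal generated by [s] forms with K^s, which forces all the generators
   to have degree q-1. *)
Lemma complete_intersection_cone (n s : nat) (v : 'I_s -> 'I_n -> nat) :
  (forall k j, (v k j <= 1)%N) -> (forall i k, v i =1 v k -> i = k) ->
  (forall i, exists j, v i j != 0%N) ->
  complete_intersection (proj_vanishing_ideal (proj_toric_set K v)) ->
  ideal_eq (proj_vanishing_ideal (proj_toric_set K v))
    (ideal_gen_by (@cone_binomial K s)).
Proof.
move=> v_le1 v_inj v_neq0 [g [g_homog IYE]].
have [d gd] := fin_all_exists g_homog.
have : forall i, exists c : 'I_s -> {mpoly K[s + 1]},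
    cone_binomial K i = \sum_k c k * g k.
  move=> i; apply/ideal_gen_byP/IYE; exact: cone_binomial_vanishing.
move=> /fin_all_exists[c bE].
pose A := \matrix_(k, j < s) (g k)@_(U_(lshift 1 j) *+ N).
(* The factor [(d k == N)%:R] makes column [k] zero for each generator of another degree. *)
pose C := \matrix_(i, k < s) ((d k == N)%:R * (c i k)@_0).
have g_pure k j : (d k < N)%N -> (g k)@_(U_(lshift 1 j) *+ d k) = 0.
  move=> dN; apply: (@pure_power_coef_eq0 n _ _ (extend0 v)) => //.
  - move=> l j'; rewrite -(splitK l); case: (split l) => a /=.
      by rewrite extend0_lshift.
    by rewrite extend0_rshift.
  - move=> l; rewrite -(splitK l) extend0_lshift; case: (split l) => a /=.
      by rewrite extend0_lshift => /v_inj->.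
    (* The variable u has exponent vector 0, which no nonempty edge has. *)
    have [j' vj'] := v_neq0 j => /(_ j'); rewrite extend0_rshift => vj0.
    by rewrite -vj0 in vj'.
  - move=> x Tx; apply: (@proj_vanishing_param K n s v) => //.
    exact/IYE/ideal_gen_by_mem.
have CA : C *m A = 1%:M.
  apply/matrixP => i j; rewrite !mxE -mcoeff_cone_binomial bE raddf_sum /=.
  apply: eq_bigr => k _; rewrite !mxE.
  (* Generators of degree below [N] lack pure powers, those above [N] have too large a degree, and
     those of degree [N] contribute through the constant term of [c i k]. *)
  have [dN|dN|dN] := ltngtP (d k) N.
  - by rewrite (mcoeff_mul_pure_power _ _ (gd k)) ?g_pure // !mul0r.
  - by rewrite (mcoeff_mul_deg_gt _ (gd k)) ?mdegMn ?mdeg1 ?mul1n // !mul0r.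
  - by rewrite mul1r (mcoeff_mul_homog _ (gd k)) ?mdegMn ?mdeg1 ?mul1n.
(* There are as many generators as variables t_j, so the matrices are square and a left inverse is a
   right inverse. *)
have AC := mulmx1C CA.
(* Otherwise column [k] of [C] is zero, while the diagonal entry of [A *m C] at [k] is 1. *)
have dN k : d k = N.
  apply/eqP; apply: contraT => /negPf dk.
  have /matrixP/(_ k k) := AC; rewrite !mxE eqxx big1.
    by move=> /eqP; rewrite eq_sym oner_eq0.
  by move=> i _; rewrite !mxE dk mul0r mulr0.
have bC i : cone_binomial K i = \sum_k C i k *: g k.
  apply/mpolyP => m.
  have gN k : g k \is N.-homog by rewrite -(dN k).
  have [mN|mN] := eqVneq (mdeg m) N.
    rewrite bE !raddf_sum; apply: eq_bigr => k _ /=.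
    by rewrite (mcoeff_mul_homog _ (gN k)) // mcoeffZ mxE dN eqxx mul1r.
  rewrite !(dhomog_nemf_coeff _ mN) ?cone_binomial_homog //.
  by rewrite rpred_sum // => k _; rewrite rpredZ.
move=> p; split=> [/IYE|]; last first.
  by apply: ideal_gen_sub => _ [i ->]; apply: cone_binomial_vanishing.
apply: ideal_gen_sub => _ [k ->].
(* The relation [bC] is inverted by [A], the inverse of [C]. *)
suff -> : g k = \sum_i A k i *: cone_binomial K i.
  apply: ideal_gen_sum => i _; rewrite -mul_mpolyC; apply: ideal_genM.
  exact: ideal_gen_by_mem.
under eq_bigr => i _ do rewrite bC scaler_sumr.
rewrite exchange_big /= (eq_bigr (fun l => (k == l)%:R *: g l)).
  rewrite (bigD1 k) //= eqxx scale1r big1 ?addr0 // => l.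
  by rewrite eq_sym => /negPf->; rewrite scale0r.
move=> l _; under eq_bigr do rewrite scalerA.
rewrite -scaler_suml; congr (_ *: _).
by have /matrixP/(_ k l) := AC; rewrite !mxE.
Qed.

End CompleteIntersection.

Theorem theorem4p5 (K : finFieldType) (q : nat) (card_K : #|K| = q)
    (q_neq2 : q <> 2%N) (n s : nat) (C : {set {set 'I_n}})
    (C_clutter : is_clutter C) (C_edges : set0 \notin C)
    (f : 'I_s -> {set 'I_n}) (f_inj : injective f)
    (f_edges : C = [set f i | i : 'I_s]) :
  let v := fun i : 'I_s => char_vec (f i) in
  let Xs : {set 'rV[K]_s} := affine_toric_set K v in
  let Y : {set {set 'rV[K]_(s + 1)}} := proj_toric_set K v in
  let t := fun i : 'I_s => 'X_(lshift 1 i) : {mpoly K[s + 1]} in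
  let u := 'X_(rshift s ord0) : {mpoly K[s + 1]} in
  [<->
    complete_intersection (proj_vanishing_ideal Y);
    ideal_eq (proj_vanishing_ideal Y)
      (ideal_gen_by (fun i : 'I_s => t i ^+ q.-1 - u ^+ q.-1));
    Xs = torus K s;
    ideal_eq (vanishing_ideal Xs)
      (ideal_gen_by (fun i : 'I_s => ('X_i : {mpoly K[s]}) ^+ q.-1 - 1))].
Proof.
move=> v Xs Y t u; rewrite -card_K; tfae.
- apply: complete_intersection_cone => [k j|i k vE|i].
  + exact: leq_b1.
  + apply/f_inj/setP => j; have := vE j; rewrite /v /char_vec.
    by case: (j \in f i); case: (j \in f k).
  have /set0Pn[j fj] : f i != set0.
    by apply: contraNneq C_edges => <-; rewrite f_edges imset_f.
  by exists j; rewrite /v /char_vec fj.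
- exact: proj_toric_full.
- by move=> XT; rewrite XT; apply: torus_vanishing_ideal.
(* The cycle closes through X* = T, over which the [s] binomials themselves generate I(Y). *)
move=> /affine_toric_full XT; exists (@cone_binomial K s); split.
  by move=> i; exists #|K|.-1; apply: cone_binomial_homog.
exact: proj_torus_ideal.
Qed.
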